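(* For each context-free grammar $G=(N,T,P,S)$ there exists a context-free grammar $G'=(N',T,P',S)$ in Dyck normal form such that $L(G)=L(G')$.
   Context: A context-free grammar $G=(N,T,P,S)$ consists of disjoint finite sets $N$ (nonterminals) and $T$ (terminals), an axiom $S\in N$, and a finite set of productions $P\subseteq N\times(N\cup T)^*$; $L(G)\subseteq T^*$ is the generated language, and $\lambda$ denotes the empty string. $G$ is in Chomsky normal form if every rule has the form $A\to BC$ or $A\to a$ with $A,B,C\in N$, $a\in T$, where in addition the rule $S\to\lambda$ is allowed provided $S$ does not occur on the right-hand side of any rule. $G$ is in Dyck normal form if: (1) $G$ is in Chomsky normal form; (2) if $A\to a\in P$ with $A\in N$, $A\ne S$, $a\in T$, then no other rule in $P$ rewrites $A$; (3) for each $A\in N$ such that $X\to AB\in P$ (respectively $X\to BA\in P$) there is no rule in $P$ of the form $X'\to B'A$ (respectively $X'\to AB'$); that is, no nonterminal occurs both as the left and as the right symbol of right-hand sides of length two; (4) for any rules $X\to AB$ and $X'\to A'B$ in $P$ one has $A=A'$, and for any rules $X\to AB$ and $X'\to AB'$ in $P$ one has $B=B'$. *)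

(* Defs.v *)
From Stdlib Require Import Relation_Operators.
From mathcomp Require Import all_boot finmap.

Set Implicit Arguments.
Unset Strict Implicit.
Unset Printing Implicit Defensive.

Local Open Scope fset_scope.

(* Nonterminals and terminals are finite subsets of one ambient type U of
   symbols, so that two grammars can literally share T and S. *)
Record cfg (U : choiceType) := Cfg {
  nonterminals : {fset U};
  terminals : {fset U};
  start : U;
  productions : {fset U * seq U};
  disjoint_symbols : [disjoint nonterminals & terminals]%fset;
  start_nonterminal : start \in nonterminals;
  productions_wf : forall (A : U) (r : seq U), (A, r) \in productions ->
    A \in nonterminals /\ {subset r <= nonterminals `|` terminals}
}.

(* The set-theoretic setting tacitly allows any finite set of symbols to be
   extended by a new one. *)
Definition infinite_symbols (U : choiceType) : Prop :=
  forall A : {fset U}, exists x : U, x \notin A.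

Section Grammar.
Variables (U : choiceType) (G : cfg U).

Local Notation N := (nonterminals G).
Local Notation T := (terminals G).
Local Notation S := (start G).
Local Notation P := (productions G).

Definition step (u v : seq U) : Prop :=
  exists (x y : seq U) (A : U) (r : seq U),
    [/\ (A, r) \in P, u = x ++ A :: y & v = x ++ r ++ y].

Definition derives : seq U -> seq U -> Prop := clos_refl_trans (seq U) step.

Definition language (w : seq U) : Prop :=
  {subset w <= T} /\ derives [:: S] w.

Definition chomsky_nf : Prop :=
  forall (A : U) (r : seq U), (A, r) \in P ->
    [\/ exists B C : U, [/\ B \in N, C \in N & r = [:: B; C]],
        exists a : U, a \in T /\ r = [:: a]
      | [/\ A = S, r = [::] &
          forall (X : U) (s : seq U), (X, s) \in P -> S \notin s]].

Definition terminal_rule_unique : Prop :=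
  forall A a : U, A \in N -> A != S -> a \in T -> (A, [:: a]) \in P ->
    forall r : seq U, (A, r) \in P -> r = [:: a].

Definition left_right_separated : Prop :=
  forall A : U, A \in N ->
    ~ ((exists X B : U, (X, [:: A; B]) \in P) /\
       (exists X' B' : U, (X', [:: B'; A]) \in P)).

Definition uniquely_paired : Prop :=
  (forall X X' A A' B : U,
     (X, [:: A; B]) \in P -> (X', [:: A'; B]) \in P -> A = A') /\
  (forall X X' A B B' : U,
     (X, [:: A; B]) \in P -> (X', [:: A; B']) \in P -> B = B').

Definition dyck_nf : Prop :=
  [/\ chomsky_nf, terminal_rule_unique, left_right_separated
    & uniquely_paired].

End Grammar.

(* Main.v *)
(* Call items the one-symbol strings and the nonempty suffixes of right-hand
   sides of G.  If an item t derives a terminal word of length at least two,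
   then t derives y z for two items y and z that derive nonempty factors of the
   word.  For each pair (y, z) take a fresh pair of brackets, the first standing
   for y and the second for z, and let a nonterminal standing for t be rewritten
   to the brackets of (y, z) exactly when t derives y z in G.  As rules are
   defined by derivability in G, empty and unit rules need no separate
   elimination, and indexing brackets by pairs gives conditions (3) and (4). *)
Require Import Defs.
From mathcomp Require Import all_boot finmap boolp.
From Stdlib Require Import Relation_Operators.

Set Implicit Arguments.
Unset Strict Implicit.
Unset Printing Implicit Defensive.

Local Open Scope fset_scope.

(** * Fresh names for finitely many indices *)

(** One fresh symbol is added per index. The decoder [g] records at once that [f] is injective on
    [s] and that its values there avoid [A]. *)
Lemma fresh_injection (U : choiceType) (K : eqType) (s : seq K) (A : {fset U}) :
  infinite_symbols U ->
  exists (f : K -> U) (g : U -> option K),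
    {in s, pcancel f g} /\ {in A, forall x, g x = None}.
Proof.
move=> hU; elim: s => [|k s [f [g [fK gA]]]].
  by have [x _] := hU fset0; exists (fun=> x), (fun=> None).
have [ks|ks] := boolP (k \in s).
  by exists f, g; split=> // k'; rewrite inE => /predU1P[->|]; apply: fK.
(* Avoiding [map f s] keeps the overridden decoder correct on [s]; avoiding [A] keeps it equal to
   [None] there. *)
have [x] := hU (A `|` [fset y in map f s]).
rewrite !inE negb_or => /andP[xA xs].
exists [eta f with k |-> x], [eta g with x |-> Some k]; split=> [k'|y yA] /=.
  rewrite inE => /predU1P[->|k's]; first by rewrite !eqxx.
  have [eqk|_] := eqVneq k' k; first by rewrite -eqk k's in ks.
  case: eqP => [eqx|_]; last exact: fK.
  by rewrite -eqx map_f in xs.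
by case: eqP => [eqx|_]; [rewrite -eqx yA in xA | apply: gA].
Qed.

(** * Derivations and derivation forests *)

Section Derivations.
Variables (U : choiceType) (G : cfg U).
Implicit Types (t u v w y z : seq U).

Lemma derives_refl u : derives G u u. Proof. exact: rt_refl. Qed.

Lemma derives_trans u v w : derives G u v -> derives G v w -> derives G u w.
Proof. exact: rt_trans. Qed.

Lemma derives_cat u u' v v' :
  derives G u u' -> derives G v v' -> derives G (u ++ v) (u' ++ v').
Proof.
move=> uu' vv'; apply: (@derives_trans _ (u' ++ v)).
  elim: uu' => [a b [x [y [A [r [Pr -> ->]]]]]|a|a b c _ ab _ bc].
  - by apply: rt_step; exists x, (y ++ v), A, r; rewrite -!catA.
  - exact: derives_refl.
  - exact: derives_trans ab bc.
elim: vv' => [a b [x [y [A [r [Pr -> ->]]]]]|a|a b c _ ab _ bc].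
- by apply: rt_step; exists (u' ++ x), y, A, r; rewrite -!catA.
- exact: derives_refl.
- exact: derives_trans ab bc.
Qed.

Lemma derives_rule A r : (A, r) \in productions G -> derives G [:: A] r.
Proof. by move=> Pr; apply: rt_step; exists [::], [::], A, r; rewrite cats0. Qed.

(* Derivation forests read from left to right; induction on them replaces
   induction on the length of a derivation. *)
Inductive gen : seq U -> seq U -> Prop :=
| gen_nil : gen [::] [::]
| gen_same x t w : gen t w -> gen (x :: t) (x :: w)
| gen_rule x r t w1 w2 : (x, r) \in productions G ->
    gen r w1 -> gen t w2 -> gen (x :: t) (w1 ++ w2).

Lemma gen_derives t w : gen t w -> derives G t w.
Proof.
elim=> [|x {}t {}w _ tw|x r {}t w1 w2 Pr _ rw _ tw].
- exact: derives_refl.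
- exact: (derives_cat (derives_refl [:: x]) tw).
- exact: (derives_cat (derives_trans (derives_rule Pr) rw) tw).
Qed.

Lemma gen_cat u u' v v' : gen u u' -> gen v v' -> gen (u ++ v) (u' ++ v').
Proof.
move=> uu' vv'; elim: uu' => [|x t w _ IH|x r t w1 w2 Pr rw _ _ IH] //=.
  exact: gen_same.
by rewrite -catA; apply: gen_rule Pr rw IH.
Qed.

Lemma gen_split u v w : gen (u ++ v) w ->
  exists w1 w2, [/\ w = w1 ++ w2, gen u w1 & gen v w2].
Proof.
elim: u w => [|x u IH] w /=.
  by move=> vw; exists [::], w; split=> //; apply: gen_nil.
move E: (x :: u ++ v) => t tw.
case: tw E => [//|x' t' w' tw|x' r t' w1 w2 Pr rw tw] [Ex Et];
  subst x' t'; have [a [b [-> ua vb]]] := IH _ tw.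
  by exists (x :: a), b; split=> //; apply: gen_same.
exists (w1 ++ a), b; rewrite catA; split=> //.
exact: gen_rule Pr rw ua.
Qed.

Lemma gen_refl t : gen t t.
Proof. by elim: t => [|x t IH]; [apply: gen_nil | apply: gen_same]. Qed.

(** A rewriting step in front of a forest is absorbed by cutting the forest around [r] and grafting
    the middle part below [A]. *)
Lemma gen_trans t u w : derives G t u -> gen u w -> gen t w.
Proof.
move=> tu; elim: tu w => [a b [x [y [A [r [Pr -> ->]]]]]|//|a b c _ ab _ bc] w.
  move=> /gen_split[w1 [_ [-> xw1 /gen_split[w2 [w3 [-> rw2 yw3]]]]]].
  by apply: gen_cat xw1 _; apply: gen_rule Pr rw2 yw3.
by move=> /bc /ab.
Qed.

Lemma derives_gen t w : derives G t w -> gen t w.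
Proof. by move=> tw; apply: gen_trans tw (gen_refl w). Qed.

(** Left-hand sides are nonterminals, so disjointness leaves a terminal with no rule to apply. *)
Lemma derives_terminal a w :
  a \in terminals G -> derives G [:: a] w -> w = [:: a].
Proof.
move=> aT /derives_gen; move E: [:: a] => t tw.
case: tw E => [//|x t' w' tw|x r t' w1 w2 Pr _ _] [ax Et].
  by case: tw Et.
have [xN _] := productions_wf Pr.
have /fdisjointP/(_ _ xN) := disjoint_symbols G.
by rewrite -ax aT.
Qed.

(** * Items and the splitting of derived words *)

Definition items : seq (seq U) :=
  [seq [:: x] | x <- nonterminals G `|` terminals G] ++
  [seq drop i p.2 | p <- productions G, i <- iota 0 (size p.2)].

Lemma symbol_item x :
  x \in nonterminals G `|` terminals G -> [:: x] \in items.
Proof. by move=> xV; rewrite mem_cat map_f. Qed.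

Lemma rhs_item A r : (A, r) \in productions G -> r != [::] -> r \in items.
Proof.
move=> Pr; rewrite -size_eq0 -lt0n => r0; rewrite mem_cat; apply/orP; right.
by apply/allpairsPdep; exists (A, r), 0; rewrite mem_iota drop0.
Qed.

Lemma item_neq0 t : t \in items -> t != [::].
Proof.
rewrite mem_cat => /orP[/mapP[x _ ->] //|].
move=> /allpairsPdep[[A r] [i [_ /=]]]; rewrite mem_iota => ir ->.
by rewrite -size_eq0 size_drop subn_eq0 -ltnNge.
Qed.

Lemma item_head x t : x :: t \in items -> [:: x] \in items.
Proof.
move=> xt; apply: symbol_item; move: xt.
rewrite mem_cat => /orP[/mapP[y yV [-> _]] //|].
move=> /allpairsPdep[[A r] [i [Pr _ /= Ext]]].
have [_] := productions_wf Pr; apply.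
by apply: (@mem_drop i); rewrite -Ext mem_head.
Qed.

Lemma item_tail x t : x :: t \in items -> t != [::] -> t \in items.
Proof.
rewrite -size_eq0 -lt0n => xt t0; move: xt.
rewrite !mem_cat => /orP[/mapP[y yV [_ t_nil]]|]; first by rewrite t_nil in t0.
move=> /allpairsPdep[[A r] [i [Pr _ /= Ext]]]; apply/orP; right.
have Et : t = drop i.+1 r by rewrite -add1n -drop_drop -Ext /= drop0.
apply/allpairsPdep; exists (A, r), i.+1; split=> //=.
by rewrite mem_iota /= add0n -subn_gt0 -size_drop -Et.
Qed.

(** The forest is cut after its first tree if that tree and the rest both yield nonempty words.
    Otherwise one side yields the whole word: the rest of the item, or the right-hand side [r] below
    the root. Both are again items, and the induction continues there. *)
Lemma item_split t w : t \in items -> derives G t w -> 1 < size w ->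
  exists y z w1 w2,
    [/\ (y \in items) && (z \in items), derives G t (y ++ z), w = w1 ++ w2,
        (w1 != [::]) && (w2 != [::]) & derives G y w1 /\ derives G z w2].
Proof.
move=> tI /derives_gen tw; elim: tw tI => {t w} [|x t w tw _|x r t w1 w2 Pr rw IHr tw IHt] //=.
  move=> xtI w0.
  have t0 : t != [::] by case: tw w0.
  exists [:: x], t, [:: x], w; rewrite (item_head xtI) (item_tail xtI) //=.
  split=> //; [exact: derives_refl|by case: (w) w0|].
  by split; [apply: derives_refl | apply: gen_derives].
move=> xtI w_gt1.
have xr := derives_rule Pr; have rw1 := gen_derives rw; have tw2 := gen_derives tw.
(* If the head is erased in [G], the erasure becomes part of the derivation of [y ++ z]. *)
have [w10|w10] := eqVneq w1 [::].
  subst w1; have t0 : t != [::] by case: tw w_gt1.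
  have [y [z [a [b [yzI tyz ab ab0 yz]]]]] := IHt (item_tail xtI t0) w_gt1.
  exists y, z, a, b; split=> //.
  exact: (derives_cat (derives_trans xr rw1) tyz).
(* If the tail is erased, the split is found below the rule rewriting [x] to [r]; chains of unit
   rules collapse in this way. *)
have [w20|w20] := eqVneq w2 [::].
  subst w2; have r0 : r != [::] by case: rw w10.
  rewrite cats0 in w_gt1 *.
  have [y [z [a [b [yzI tyz ab ab0 yz]]]]] := IHr (rhs_item Pr r0) w_gt1.
  exists y, z, a, b; split=> //.
  by rewrite -[y ++ z]cats0; apply: (derives_cat (derives_trans xr tyz) tw2).
have t0 : t != [::] by case: tw w20.
exists [:: x], t, w1, w2; rewrite (item_head xtI) (item_tail xtI) // w10 w20.
split=> //; first exact: derives_refl.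
by split=> //; apply: derives_trans rw1.
Qed.

Lemma terminal_word_item w :
  {subset w <= terminals G} -> size w = 1 -> w \in items.
Proof.
case: w => [|a [|//]] // wT _; apply: symbol_item.
by rewrite inE wT ?orbT // mem_head.
Qed.

(* Pieces that derive a single letter are replaced by that letter, so that only
   terminal items ever need a terminal rule, as condition (2) demands. *)
Lemma item_split_terminal t w :
  {subset w <= terminals G} -> t \in items -> derives G t w -> 1 < size w ->
  exists y z w1 w2,
    [/\ (y \in items) && (z \in items), derives G t (y ++ z), w = w1 ++ w2,
        (w1 != [::]) && (w2 != [::]) &
        [/\ derives G y w1, derives G z w2,
            size w1 = 1 -> y = w1 & size w2 = 1 -> z = w2]].
Proof.
move=> wT tI tw w_gt1.
have [y [z [w1 [w2 [/andP[yI zI] tyz Ew w0 [yw zw]]]]]] := item_split tI tw w_gt1.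
have sharpen v v1 : {subset v1 <= terminals G} -> v \in items -> derives G v v1 ->
    exists v', [/\ v' \in items, derives G v v', derives G v' v1
                 & size v1 = 1 -> v' = v1].
  move=> v1T vI vv1; have [s1|s1] := eqVneq (size v1) 1.
    by exists v1; split=> //; [apply: terminal_word_item | apply: derives_refl].
  by exists v; split=> // [|s]; [apply: derives_refl | rewrite s in s1].
have w1T : {subset w1 <= terminals G}.
  by move=> a aw; apply: wT; rewrite Ew mem_cat aw.
have w2T : {subset w2 <= terminals G}.
  by move=> a aw; apply: wT; rewrite Ew mem_cat aw orbT.
have [y' [y'I yy' y'w y's]] := sharpen _ _ w1T yI yw.
have [z' [z'I zz' z'w z's]] := sharpen _ _ w2T zI zw.
exists y', z', w1, w2; rewrite y'I z'I; split=> //.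
exact: derives_trans tyz (derives_cat yy' zz').
Qed.

End Derivations.

(** * The grammar on brackets *)

Section DyckGrammar.
Variables (U : choiceType) (G : cfg U).
Local Notation N := (nonterminals G).
Local Notation T := (terminals G).
Local Notation S := (start G).

(* [(false, y, z)] and [(true, y, z)] are the opening and the closing bracket
   of the pair of items [y], [z]; they generate [y] and [z] respectively. *)
Definition bracket := (bool * seq U * seq U)%type.

Definition bracket_item (k : bracket) : seq U := if k.1.1 then k.2 else k.1.2.

Definition brackets : seq bracket :=
  [seq (c, z) | c <- [seq (b, y) | b <- [:: false; true], y <- items G],
                z <- items G].

Lemma mem_brackets b y z :
  y \in items G -> z \in items G -> (b, y, z) \in brackets.
Proof.
by move=> yI zI; do 2!apply: allpairs_f => //; case: b.
Qed.

Variables (f : bracket -> U) (g : U -> option bracket).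
Hypothesis fK : {in brackets, pcancel f g}.
Hypothesis gNT : {in N `|` T, forall x, g x = None}.

(** Translates back to [G]: brackets become their items, while symbols without a decoding, among
    them [S] and the terminals, stand for themselves. *)
Definition meaning (x : U) : seq U := oapp bracket_item [:: x] (g x).

Definition meanings (u : seq U) : seq U := flatten (map meaning u).

Lemma meaning_f k : k \in brackets -> meaning (f k) = bracket_item k.
Proof. by move=> kB; rewrite /meaning fK. Qed.

Lemma meaning_old x : x \in N `|` T -> meaning x = [:: x].
Proof. by move=> xV; rewrite /meaning gNT. Qed.

Lemma meanings_terminal w : {subset w <= T} -> meanings w = w.
Proof.
elim: w => [//|a w IH] wT; rewrite /meanings /= meaning_old.
  by rewrite [flatten _]IH // => x xw; apply: wT; rewrite inE xw orbT.
by rewrite inE wT ?orbT ?mem_head.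
Qed.

Lemma f_fresh k : k \in brackets -> f k \notin N `|` T.
Proof. by move=> kB; apply/negP => /gNT; rewrite fK. Qed.

Lemma f_neq_start k : k \in brackets -> f k != S.
Proof.
move=> /f_fresh; apply: contra => /eqP ->.
by rewrite inE start_nonterminal.
Qed.

Lemma terminal_neq_start a : a \in T -> a != S.
Proof.
apply: contraTneq => ->.
by have /fdisjointP := disjoint_symbols G; apply; apply: start_nonterminal.
Qed.

Lemma f_inj : {in brackets &, injective f}.
Proof. by move=> k k' kB k'B ff; apply: Some_inj; rewrite -!fK // ff. Qed.

Definition pair_rhs y z := [:: f (false, y, z); f (true, y, z)].

Lemma meanings_pair_rhs y z :
  y \in items G -> z \in items G -> meanings (pair_rhs y z) = y ++ z.
Proof.
by move=> yI zI; rewrite /meanings /= !meaning_f ?mem_brackets // cats0.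
Qed.

Definition dyck_nonterminals : {fset U} := S |` [fset x in map f brackets].

(** In the terminal case only [S], which condition (2) exempts, may use a mere derivation of [a]. A
    bracket must stand for the letter itself, or it could have pair rules as well. *)
Definition dyck_rule (X : U) (r : seq U) : Prop :=
  [/\ X \in dyck_nonterminals, derives G (meaning X) (meanings r) &
   [\/ X = S /\ r = [::],
       exists a, [/\ a \in T, r = [:: a] & X = S \/ meaning X = [:: a]] |
       exists y z, [/\ y \in items G, z \in items G & r = pair_rhs y z]]].

Definition candidate_rhs : seq (seq U) :=
  [::] :: [seq [:: a] | a <- T] ++
  [seq pair_rhs y z | y <- items G, z <- items G].

(** Derivability in [G] is a bare proposition, so a finite list of candidates is filtered by the
    classical truth value of [dyck_rule]. *)
Definition dyck_productions : {fset U * seq U} :=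
  [fset p in [seq p <- [seq (X, r) | X <- dyck_nonterminals, r <- candidate_rhs]
             | `[< dyck_rule p.1 p.2 >]]].

Lemma dyck_productionsP X r : (X, r) \in dyck_productions <-> dyck_rule X r.
Proof.
rewrite inE mem_filter; split=> [/andP[/asboolP]//|Xr].
apply/andP; split; first exact/asboolP.
have [XN _ rP] := Xr; apply/allpairsP; exists (X, r); split=> //=.
rewrite inE mem_cat; case: rP => [[_ ->] //|[a [aT -> _]]|[y [z [yI zI ->]]]].
  by rewrite map_f ?orbT.
by apply/or3P/Or33/allpairsP; exists (y, z).
Qed.

Lemma dyck_disjoint : [disjoint dyck_nonterminals & T].
Proof.
apply/fdisjointP => x; rewrite !inE => /predU1P[->|/mapP[k kB ->]].
  exact: contraL (@terminal_neq_start S) (eqxx S).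
by have := f_fresh kB; rewrite inE negb_or => /andP[].
Qed.

Lemma dyck_start : S \in dyck_nonterminals.
Proof. by rewrite !inE eqxx. Qed.

Lemma f_dyck k : k \in brackets -> f k \in dyck_nonterminals.
Proof. by move=> kB; rewrite !inE map_f ?orbT. Qed.

Lemma dyck_wf A r : (A, r) \in dyck_productions ->
  A \in dyck_nonterminals /\ {subset r <= dyck_nonterminals `|` T}.
Proof.
move=> /dyck_productionsP[AN _ rP]; split=> // x.
case: rP => [[_ ->] //|[a [aT -> _]]|[y [z [yI zI ->]]]].
  by rewrite inE => /eqP->; rewrite inE aT orbT.
by rewrite !inE => /orP[]/eqP->; rewrite map_f ?orbT ?mem_brackets.
Qed.

Definition dyck_grammar : cfg U := Cfg dyck_disjoint dyck_start dyck_wf.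

(** * The conditions of Dyck normal form *)

(** Length two singles out the third kind of rule, so conditions (3) and (4) reduce to comparing
    indices of brackets. *)
Lemma dyck_rule_pair X A B : dyck_rule X [:: A; B] ->
  exists y z, [/\ y \in items G, z \in items G,
                  A = f (false, y, z) & B = f (true, y, z)].
Proof.
by case=> _ _ [[]//|[? []]//|[y [z [yI zI [-> ->]]]]]; exists y, z.
Qed.

Lemma dyck_grammar_nf : dyck_nf dyck_grammar.
Proof.
split.
- move=> A r /dyck_productionsP[AN _].
  case=> [[-> ->]|[a [aT -> _]]|[y [z [yI zI ->]]]].
  (* Right-hand sides consist of terminals and brackets, all different from [S]. *)
  + apply: Or33; split=> // X s /dyck_productionsP[_ _].
    case=> [[_ ->] //|[a [aT -> _]]|[y [z [yI zI ->]]]].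
      by rewrite inE eq_sym terminal_neq_start.
    by rewrite !inE negb_or ![S == _]eq_sym !f_neq_start ?mem_brackets.
  + by apply: Or32; exists a.
  + apply: Or31; exists (f (false, y, z)), (f (true, y, z)).
    by split=> //; apply: f_dyck; apply: mem_brackets.
- move=> A a AN /eqP AS aT /dyck_productionsP[_ _].
  case=> [[]//|[_ [_ [<-] [//|mA]]]|[? [? []]] //] r.
  move=> /dyck_productionsP[_ mAr [[]//|[b [_ -> [//|]]]|[y [z [yI zI Er]]]]].
    by rewrite mA => -[->].
  (* A pair rule would let the letter [a] derive two nonempty items, but a terminal derives only
     itself. *)
  have /(congr1 size) : y ++ z = [:: a].
    apply: (@derives_terminal _ G _ _ aT); rewrite -mA.
    by rewrite -meanings_pair_rhs // -Er.
  have := item_neq0 yI; have := item_neq0 zI.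
  by case: (y) => // ? ?; case: (z) => // ? ?; rewrite /= size_cat /= addnS.
(* A bracket occurring on both sides would carry both tags [false] and [true]. *)
- move=> A _ [[X [B /dyck_productionsP/dyck_rule_pair[y [z [yI zI Ef _]]]]]].
  move=> [X' [B' /dyck_productionsP/dyck_rule_pair[y' [z' [y'I z'I _]]]]].
  by rewrite Ef => /f_inj; rewrite !mem_brackets // => /(_ isT isT).
(* Either bracket determines its pair of items, hence its partner. *)
- split=> X X' A B C
    /dyck_productionsP/dyck_rule_pair[y [z [yI zI -> ->]]]
    /dyck_productionsP/dyck_rule_pair[y' [z' [y'I z'I]]].
    by move=> -> /f_inj; rewrite !mem_brackets // => /(_ isT isT)[-> ->].
  by move=> /f_inj; rewrite !mem_brackets // => /(_ isT isT)[-> ->].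
Qed.

(** * Equality of the languages *)

(** [meanings] is a homomorphism, and it turns each rule into a derivation in [G] by the definition
    of [dyck_rule]. *)
Lemma dyck_grammar_sound u v :
  derives dyck_grammar u v -> derives G (meanings u) (meanings v).
Proof.
elim=> [a b [x [y [A [r [/dyck_productionsP[_ Ar _] -> ->]]]]]|a|a b c _ ab _ bc].
- rewrite /meanings !map_cat !flatten_cat /=.
  by apply/derives_cat/derives_cat => //; apply: derives_refl.
- exact: derives_refl.
- exact: derives_trans ab bc.
Qed.

(** Strong induction on the length of [w]: longer words are split by [item_split_terminal], single
    letters end with a terminal rule. The last hypothesis makes that terminal rule available. *)
Lemma dyck_grammar_complete X (w : seq U) :
  X \in dyck_nonterminals -> meaning X \in items G -> {subset w <= T} ->
  w != [::] -> derives G (meaning X) w ->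
  (size w = 1 -> X = S \/ meaning X = w) -> derives dyck_grammar [:: X] w.
Proof.
have [n] := ubnP (size w); elim: n X w => // n IH X w.
rewrite ltnS => sw XN XI wT w0 Xw w1.
case: (ltngtP (size w) 1) => [|w_gt1|sw1].
- by rewrite ltnS leqn0 size_eq0 (negPf w0).
- have [y [z [a [b [/andP[yI zI] Xyz Ew /andP[a0 b0] [ya zb a1 b1]]]]]] :=
    item_split_terminal wT XI Xw w_gt1.
  have Xr : derives dyck_grammar [:: X] (pair_rhs y z).
    apply/derives_rule/dyck_productionsP; split=> //.
      by rewrite meanings_pair_rhs.
    by apply: Or33; exists y, z.
  apply: derives_trans Xr _.
  have aT : {subset a <= T} by move=> x xa; apply: wT; rewrite Ew mem_cat xa.
  have bT : {subset b <= T}.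
    by move=> x xb; apply: wT; rewrite Ew mem_cat xb orbT.
  have sab : (size a < n) && (size b < n).
    move: a0 b0 sw; rewrite Ew size_cat -!size_eq0 -!lt0n => a0 b0 sw.
    apply/andP; split; apply: leq_trans sw; first by rewrite -addn1 leq_add2l.
    by rewrite -add1n leq_add2r.
  have [sa sb] := andP sab.
  rewrite Ew -[pair_rhs y z]/([:: f (false, y, z)] ++ [:: f (true, y, z)]).
  have yzB c := mem_brackets c yI zI.
  (* For a factor of one letter the split has made its item equal to that letter, so the last
     hypothesis is passed on. *)
  apply: derives_cat; apply: IH; rewrite ?meaning_f ?f_dyck // => s1; right.
    exact: a1.
  exact: b1.
- case: w wT Xw w1 sw1 {w0 sw} => [|a [|//]] // wT Xw /(_ erefl) w1 _.
  apply/derives_rule/dyck_productionsP; split=> //.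
    by rewrite meanings_terminal.
  by apply: Or32; exists a; split=> //; apply: wT; apply: mem_head.
Qed.

Lemma dyck_grammar_language w : language G w <-> language dyck_grammar w.
Proof.
have SV : S \in N `|` T by rewrite inE start_nonterminal.
have mS := meaning_old SV.
split=> -[wT Sw]; split=> //.
  (* The empty word, excluded from completeness, comes directly from the rule erasing [S], present
     because [G] derives it. *)
  have [w0|w0] := eqVneq w [::].
    subst w; apply/derives_rule/dyck_productionsP; split; first exact: dyck_start.
      by rewrite mS.
    exact: Or31.
  apply: dyck_grammar_complete => //; rewrite ?mS //; first exact: dyck_start.
  - exact: symbol_item.
  - by move=> _; left.
by have := dyck_grammar_sound Sw; rewrite /meanings /= mS [flatten _]meanings_terminal.
Qed.

End DyckGrammar.

Theorem theorem1p2 (U : choiceType) (hU : infinite_symbols U) (G : cfg U) :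
  exists G' : cfg U,
    terminals G' = terminals G /\
    start G' = start G /\
    dyck_nf G' /\
    (forall w : seq U, language G w <-> language G' w).
Proof.
have [f [g [fK gNT]]] :=
  fresh_injection (brackets G) (nonterminals G `|` terminals G) hU.
exists (dyck_grammar fK gNT); do 2!split=> //.
split; [exact: dyck_grammar_nf | exact: dyck_grammar_language].
Qed.
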